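(* Let $B$ be an algebra with a covering $(J_i)_{i\in I}$, put $B_i=B/J_i$, and let differential calculi $\Gamma(B_i)$ over the algebras $B_i$, $i\in I$, be given. Then there exists a differential calculus $\Gamma(B)$ over $B$, unique up to isomorphism, such that $(\Gamma(B),(\Gamma(B_i))_{i\in I})$ is adapted to $(B,(J_i)_{i\in I})$.
   Context: Algebras are associative unital algebras over $\mathbb{C}$; ideals are two-sided. A finite family of ideals of an algebra is a covering of it if their intersection is $\{0\}$. A differential algebra over $B$ is an $\mathbb{N}$-graded algebra $\Gamma(B)=\bigoplus_{n\ge0}\Gamma^n(B)$ with $\Gamma^0(B)=B$ and a linear map $d$ with $d\Gamma^n(B)\subset\Gamma^{n+1}(B)$, $d(\rho\eta)=(d\rho)\eta+(-1)^n\rho\, d\eta$ for $\rho\in\Gamma^n(B)$, and $d^2=0$. It is a differential calculus if every element of $\Gamma^n(B)$ is a finite sum of elements $a_0\,da_1\cdots da_n$ with $a_k\in B$. A homomorphism of differential algebras is a degree-preserving algebra homomorphism commuting with $d$. An algebra homomorphism $\Psi:A\to B$ is differentiable with respect to $\Gamma(A),\Gamma(B)$ if it extends to a homomorphism of differential algebras $\Psi_\Gamma:\Gamma(A)\to\Gamma(B)$ (unique if $\Gamma(A)$ is a differential calculus). Given an algebra $B$ with covering $(J_i)_{i\in I}$, $B_i=B/J_i$, quotient maps $\pi_i:B\to B_i$, and differential calculi $\Gamma(B)$, $\Gamma(B_i)$, the pair $(\Gamma(B),(\Gamma(B_i))_{i\in I})$ is called adapted to $(B,(J_i)_{i\in I})$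 if all $\pi_i$ are differentiable and $(\ker \pi_{i_\Gamma})_{i\in I}$ is a covering of $\Gamma(B)$, i.e. $\bigcap_{i}\ker\pi_{i_\Gamma}=\{0\}$. Isomorphism of differential calculi over $B$ means isomorphism of differential algebras that is the identity on $B$. *)

(* Defs.v *)
From HB Require Import structures.
From mathcomp Require Import all_boot all_order all_algebra.
From mathcomp Require Import generic_quotient ring_quotient.
From mathcomp Require Import reals.
From mathcomp.real_closed Require Export complex.

Set Implicit Arguments.
Unset Strict Implicit.
Unset Printing Implicit Defensive.

Import GRing.Theory.
Local Open Scope ring_scope.
Local Open Scope quotient_scope.

(* The library's [algType K] requires [1 != 0]. This would exclude the zero
   algebra, which arises as the quotient by an improper ideal; the structure
   below is [algType] without that axiom. *)
Record pzAlgType (K : pzRingType) := PzAlgebra {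
  pz_ring : pzRingType;
  pz_scale : K -> pz_ring -> pz_ring;
  pz_scaleA : forall a b x, pz_scale a (pz_scale b x) = pz_scale (a * b) x;
  pz_scale1 : left_id 1 pz_scale;
  pz_scaleDr : right_distributive pz_scale +%R;
  pz_scaleDl : forall x, {morph pz_scale^~ x : a b / a + b};
  pz_scaleAl : forall k x y, pz_scale k (x * y) = pz_scale k x * y;
  pz_scaleAr : forall k x y, pz_scale k (x * y) = x * pz_scale k y
}.

Section PzAlgebraInstances.
Variables (K : pzRingType) (A : pzAlgType K).

(* Both the ring and the module structure are keyed on this constant. *)
Definition pz_sort : Type := pz_ring A.
HB.instance Definition _ := GRing.PzRing.on pz_sort.
HB.instance Definition _ := GRing.Zmodule_isLmodule.Build K pz_sort
  (@pz_scaleA K A) (@pz_scale1 K A) (@pz_scaleDr K A) (@pz_scaleDl K A).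

Definition pz_to_ring : pzRingType := pz_sort.
Definition pz_to_lmod : lmodType K := pz_sort.
End PzAlgebraInstances.

Coercion pz_sort : pzAlgType >-> Sortclass.
Coercion pz_to_ring : pzAlgType >-> GRing.PzRing.type.
Coercion pz_to_lmod : pzAlgType >-> GRing.Lmodule.type.

Fact pz_scalerAl (K : pzRingType) (A : pzAlgType K) (k : K) (x y : A) :
  k *: (x * y) = (k *: x) * y.
Proof. exact: pz_scaleAl. Qed.

Fact pz_scalerAr (K : pzRingType) (A : pzAlgType K) (k : K) (x y : A) :
  k *: (x * y) = x * (k *: y).
Proof. exact: pz_scaleAr. Qed.

Record algHom (K : pzRingType) (A B : pzAlgType K) := AlgHom {
  alg_hom :> {linear A -> B};
  alg_homM : monoid_morphism alg_hom
}.

(* Membership in an ideal is boolean, as everywhere in the library; under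
   classical logic this is no restriction on the ideals considered.
   The ideal is allowed to be improper, unlike the library's [idealr]. *)
Record twoSidedIdeal (K : pzRingType) (A : pzAlgType K) := TwoSidedIdeal {
  ideal_pred :> {pred A};
  ideal_zmod : zmod_closed ideal_pred;
  idealMl : forall a u : A, u \in ideal_pred -> a * u \in ideal_pred;
  idealMr : forall a u : A, u \in ideal_pred -> u * a \in ideal_pred
}.

HB.instance Definition _ (K : pzRingType) (A : pzAlgType K)
    (J : twoSidedIdeal A) :=
  GRing.isZmodClosed.Build A (ideal_pred J) (ideal_zmod J).

Definition ideal_closed (K : pzRingType) (A : pzAlgType K)
    (J : twoSidedIdeal A) : zmodClosed A :=
  GRing.ZmodClosed.clone A (ideal_pred J) _.

Definition covering (K : pzRingType) (A : pzAlgType K) (I : finType)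
    (J : I -> twoSidedIdeal A) :=
  forall x : A, (forall i, x \in J i) <-> x = 0.

Section Kernel.
Variables (K : pzRingType) (A B : pzAlgType K) (f : algHom A B).

Definition ker : {pred A} := fun x => f x == 0.

Fact ker_zmod_closed : zmod_closed ker.
Proof.
split=> [|x y]; rewrite !unfold_in /ker ?linear0 // => /eqP fx /eqP fy.
by rewrite linearB fx fy subrr.
Qed.

Fact ker_Ml (a u : A) : u \in ker -> a * u \in ker.
Proof.
by rewrite !unfold_in /ker (alg_homM f).2 => /eqP ->; rewrite mulr0.
Qed.

Fact ker_Mr (a u : A) : u \in ker -> u * a \in ker.
Proof.
by rewrite !unfold_in /ker (alg_homM f).2 => /eqP ->; rewrite mul0r.
Qed.

Definition kerI : twoSidedIdeal A :=
  TwoSidedIdeal ker_zmod_closed ker_Ml ker_Mr.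
End Kernel.

Section QuotientAlgebra.
Variables (K : pzRingType) (A : pzAlgType K) (J : twoSidedIdeal A).

(* [Quotient.quot] is the quotient of abelian groups; the library puts a ring
   structure on it only when [A] is commutative and nonzero. *)
Definition quotRing : Type := Quotient.quot (ideal_closed J).
HB.instance Definition _ := GRing.Zmodule.on quotRing.

Definition quot_proj (x : A) : quotRing :=
  \pi_(Quotient.quot (ideal_closed J)) x.

Fact quot_projD x y : quot_proj (x + y) = quot_proj x + quot_proj y.
Proof. by rewrite /quot_proj Quotient.pi_add. Qed.

Fact quot_projP x y : reflect (quot_proj x = quot_proj y) (x - y \in J).
Proof. by rewrite Quotient.idealrBE; apply: eqP. Qed.

Definition quot_repr (x : quotRing) : A :=
  repr (x : Quotient.quot (ideal_closed J)).

Fact quot_reprK : cancel quot_repr quot_proj.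
Proof. by move=> x; apply: reprK. Qed.

Fact quot_repr_proj x : quot_repr (quot_proj x) - x \in J.
Proof. by apply/quot_projP; rewrite quot_reprK. Qed.

Fact ideal_scale (k : K) (x : A) : x \in J -> k *: x \in J.
Proof. by move=> xJ; rewrite -[x]mul1r pz_scalerAl idealMl. Qed.

Definition quot_one : quotRing := quot_proj 1.
Definition quot_mul (x y : quotRing) := quot_proj (quot_repr x * quot_repr y).
Definition quot_scale (k : K) (x : quotRing) := quot_proj (k *: quot_repr x).

Fact quot_projM x y :
  quot_proj (x * y) = quot_mul (quot_proj x) (quot_proj y).
Proof.
symmetry; apply/quot_projP.
rewrite -[_ * _](addrNK (quot_repr (quot_proj x) * y)) -mulrBr -addrA -mulrBl.
by apply: rpredD; [apply: idealMl | apply: idealMr]; apply: quot_repr_proj.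
Qed.

Fact quot_projZ k x : quot_proj (k *: x) = quot_scale k (quot_proj x).
Proof.
by symmetry; apply/quot_projP; rewrite -scalerBr ideal_scale ?quot_repr_proj.
Qed.

Fact quot_mulA : associative quot_mul.
Proof.
move=> x y z; rewrite -[x]quot_reprK -[y]quot_reprK -[z]quot_reprK.
by rewrite -!quot_projM mulrA.
Qed.

Fact quot_mul1l : left_id quot_one quot_mul.
Proof. by move=> x; rewrite -[x]quot_reprK -quot_projM mul1r. Qed.

Fact quot_mul1r : right_id quot_one quot_mul.
Proof. by move=> x; rewrite -[x]quot_reprK -quot_projM mulr1. Qed.

Fact quot_mulDl : left_distributive quot_mul +%R.
Proof.
move=> x y z; rewrite -[x]quot_reprK -[y]quot_reprK -[z]quot_reprK.
by rewrite -quot_projD -!quot_projM -quot_projD mulrDl.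
Qed.

Fact quot_mulDr : right_distributive quot_mul +%R.
Proof.
move=> x y z; rewrite -[x]quot_reprK -[y]quot_reprK -[z]quot_reprK.
by rewrite -quot_projD -!quot_projM -quot_projD mulrDr.
Qed.

HB.instance Definition _ := GRing.Zmodule_isPzRing.Build quotRing
  quot_mulA quot_mul1l quot_mul1r quot_mulDl quot_mulDr.

Fact quot_scaleA a b x : quot_scale a (quot_scale b x) = quot_scale (a * b) x.
Proof. by rewrite -[x]quot_reprK -!quot_projZ scalerA. Qed.

Fact quot_scale1 : left_id 1 quot_scale.
Proof. by move=> x; rewrite -[x]quot_reprK -quot_projZ scale1r. Qed.

Fact quot_scaleDr : right_distributive quot_scale +%R.
Proof.
move=> k x y; rewrite -[x]quot_reprK -[y]quot_reprK.
by rewrite -quot_projD -!quot_projZ -quot_projD scalerDr.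
Qed.

Fact quot_scaleDl x : {morph quot_scale^~ x : a b / a + b}.
Proof.
by move=> a b; rewrite -[x]quot_reprK -!quot_projZ -quot_projD scalerDl.
Qed.

Fact quot_scaleAl k (x y : quotRing) :
  quot_scale k (x * y) = quot_scale k x * y.
Proof.
rewrite -[x]quot_reprK -[y]quot_reprK -[_ * _]quot_projM -!quot_projZ.
by rewrite -[RHS]quot_projM pz_scalerAl.
Qed.

Fact quot_scaleAr k (x y : quotRing) :
  quot_scale k (x * y) = x * quot_scale k y.
Proof.
rewrite -[x]quot_reprK -[y]quot_reprK -[_ * _]quot_projM -!quot_projZ.
by rewrite -[RHS]quot_projM pz_scalerAr.
Qed.

Definition quotAlg : pzAlgType K := @PzAlgebra K quotRing quot_scale
  quot_scaleA quot_scale1 quot_scaleDr quot_scaleDl quot_scaleAl quot_scaleAr.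

Definition quot_proj_alg : A -> quotAlg := quot_proj.

Fact quot_proj_linear : linear quot_proj_alg.
Proof. by move=> k x y; rewrite /quot_proj_alg quot_projD quot_projZ. Qed.

HB.instance Definition _ :=
  GRing.isLinear.Build K A quotAlg *:%R quot_proj_alg quot_proj_linear.

Fact quot_proj_monoid : monoid_morphism quot_proj_alg.
Proof. by split=> // x y; rewrite /quot_proj_alg quot_projM. Qed.

Definition quot_pi : algHom A quotAlg := AlgHom quot_proj_monoid.
End QuotientAlgebra.

(* [gr n] is the n-th homogeneous component; the last two clauses say that the
   algebra is the internal direct sum of the [gr n]. *)
Definition is_grading (K : pzRingType) (G : pzAlgType K)
    (gr : nat -> {pred G}) : Prop :=
  [/\ forall n, submod_closed (gr n),
      1 \in gr 0%N /\
        (forall m n x y, x \in gr m -> y \in gr n -> x * y \in gr (m + n)%N),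
      forall x, exists (N : nat) (c : nat -> G),
        (forall n, c n \in gr n) /\ x = \sum_(n < N) c n
    & forall (N : nat) (c : nat -> G), (forall n, c n \in gr n) ->
        \sum_(n < N) c n = 0 -> forall n, (n < N)%N -> c n = 0].

(* The equality of [B] with the degree-zero part is an algebra isomorphism
   [da_in] of [B] onto [da_gr 0]. *)
Record diffAlg (K : pzRingType) (B : pzAlgType K) := DiffAlg {
  da_alg :> pzAlgType K;
  da_gr : nat -> {pred da_alg};
  da_in : algHom B da_alg;
  da_d : {linear da_alg -> da_alg};
  da_grading : is_grading da_gr;
  da_in_inj : injective da_in;
  da_gr0 : forall x, x \in da_gr 0%N <-> exists b, x = da_in b;
  da_d_deg : forall n x, x \in da_gr n -> da_d x \in da_gr n.+1;
  da_leibniz : forall n x y, x \in da_gr n ->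
    da_d (x * y) = da_d x * y + (-1) ^+ n *: (x * da_d y);
  da_dd : forall x, da_d (da_d x) = 0
}.

Arguments da_gr {K B} G n : rename.
Arguments da_in {K B} G : rename.
Arguments da_d {K B} G : rename.

(* Each [t] in [s] encodes the monomial [a_0 da_1 ... da_n], with
   [a_0 = t.1] and [(a_1, ..., a_n) = t.2]. *)
Definition is_calculus (K : pzRingType) (B : pzAlgType K) (G : diffAlg B) :=
  forall (n : nat) (x : G), x \in da_gr G n ->
    exists s : seq (B * n.-tuple B),
      x = \sum_(t <- s) da_in G t.1 * \prod_(a <- t.2) da_d G (da_in G a).

Record diffHom (K : pzRingType) (A B : pzAlgType K)
    (GA : diffAlg A) (GB : diffAlg B) := DiffHom {
  diff_hom :> algHom GA GB;
  diff_hom_deg : forall n x, x \in da_gr GA n -> diff_hom x \in da_gr GB n;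
  diff_hom_d : forall x, diff_hom (da_d GA x) = da_d GB (diff_hom x)
}.

Definition extends (K : pzRingType) (A B : pzAlgType K)
    (GA : diffAlg A) (GB : diffAlg B) (F : diffHom GA GB) (psi : A -> B) :=
  forall a : A, F (da_in GA a) = da_in GB (psi a).

(* [piG i] witnesses that the i-th quotient map is differentiable.  These
   extensions are unique when [G] is a calculus, so that quantifying them
   existentially is unambiguous. *)
Definition adapted (K : pzRingType) (B : pzAlgType K) (I : finType)
    (J : I -> twoSidedIdeal B)
    (G : diffAlg B) (Gq : forall i, diffAlg (quotAlg (J i))) :=
  exists piG : forall i, diffHom G (Gq i),
    (forall i, extends (piG i) (quot_pi (J i))) /\
    covering (fun i => kerI (piG i)).

Definition calculus_iso (K : pzRingType) (B : pzAlgType K)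
    (G G' : diffAlg B) :=
  exists (f : diffHom G G') (g : diffHom G' G),
    [/\ cancel f g, cancel g f & extends f id].

(* Main.v *)
From HB Require Import structures.
Require Import Defs.
From mathcomp Require Import all_boot all_order all_algebra reals.
From mathcomp Require Import boolp.

Set Implicit Arguments.
Unset Strict Implicit.
Unset Printing Implicit Defensive.

Import GRing.Theory.
Local Open Scope ring_scope.

(* Uniqueness and existence both rest on the homomorphism from a calculus into
   the product of the calculi [Gq i]: it is injective exactly when the
   calculus is adapted, and it is determined by the quotient maps because
   every element is a sum of monomials [a_0 da_1 ... da_n]. Hence its image
   must be the span of these monomials, formed inside the product. This span
   is stable under multiplication, as [(da) b = d(ab) - a db], and under [d],
   and it meets degree zero in the image of [B], which is a copy of [B]
   because the [J i] form a covering. *)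

(** * Products of families of algebras *)

Section ProductAlgebra.
Variables (K : pzRingType) (I : Type) (A : I -> pzAlgType K).

Definition prodT : Type := forall i, A i.
HB.instance Definition _ := Choice.copy prodT (forall i, A i).

Implicit Types x y z : prodT.

Fact prod_addA : associative (fun x y : prodT => (fun i => x i + y i) : prodT).
Proof.
by move=> x y z; apply: functional_extensionality_dep => i; apply: addrA.
Qed.
Fact prod_addC : commutative (fun x y : prodT => (fun i => x i + y i) : prodT).
Proof.
by move=> x y; apply: functional_extensionality_dep => i; apply: addrC.
Qed.
Fact prod_add0 : left_id ((fun=> 0) : prodT)
  (fun x y : prodT => (fun i => x i + y i) : prodT).
Proof.
by move=> x; apply: functional_extensionality_dep => i; apply: add0r.
Qed.
Fact prod_addN : left_inverse ((fun=> 0) : prodT)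
  (fun x : prodT => (fun i => - x i) : prodT)
  (fun x y : prodT => (fun i => x i + y i) : prodT).
Proof.
by move=> x; apply: functional_extensionality_dep => i; apply: addNr.
Qed.
HB.instance Definition _ :=
  GRing.isZmodule.Build prodT prod_addA prod_addC prod_add0 prod_addN.

Let mul x y : prodT := fun i => x i * y i.
Let one : prodT := fun i => 1.

Fact prod_mulA : associative mul.
Proof.
by move=> x y z; apply: functional_extensionality_dep => i; apply: mulrA.
Qed.
Fact prod_mul1l : left_id one mul.
Proof.
by move=> x; apply: functional_extensionality_dep => i; apply: mul1r.
Qed.
Fact prod_mul1r : right_id one mul.
Proof.
by move=> x; apply: functional_extensionality_dep => i; apply: mulr1.
Qed.
Fact prod_mulDl : left_distributive mul +%R.
Proof.
by move=> x y z; apply: functional_extensionality_dep => i; apply: mulrDl.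
Qed.
Fact prod_mulDr : right_distributive mul +%R.
Proof.
by move=> x y z; apply: functional_extensionality_dep => i; apply: mulrDr.
Qed.
HB.instance Definition _ := GRing.Zmodule_isPzRing.Build prodT
  prod_mulA prod_mul1l prod_mul1r prod_mulDl prod_mulDr.

Let scale (k : K) x : prodT := fun i => k *: x i.

Fact prod_scaleA a b x : scale a (scale b x) = scale (a * b) x.
Proof. by apply: functional_extensionality_dep => i; apply: scalerA. Qed.
Fact prod_scale1 : left_id 1 scale.
Proof.
by move=> x; apply: functional_extensionality_dep => i; apply: scale1r.
Qed.
Fact prod_scaleDr : right_distributive scale +%R.
Proof.
by move=> k x y; apply: functional_extensionality_dep => i; apply: scalerDr.
Qed.
Fact prod_scaleDl x : {morph scale^~ x : a b / a + b}.
Proof.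
by move=> a b; apply: functional_extensionality_dep => i; apply: scalerDl.
Qed.
Fact prod_scaleAl k x y : scale k (x * y) = scale k x * y.
Proof. by apply: functional_extensionality_dep => i; apply: pz_scalerAl. Qed.
Fact prod_scaleAr k x y : scale k (x * y) = x * scale k y.
Proof. by apply: functional_extensionality_dep => i; apply: pz_scalerAr. Qed.

Definition prodAlg : pzAlgType K := @PzAlgebra K prodT scale
  prod_scaleA prod_scale1 prod_scaleDr prod_scaleDl prod_scaleAl prod_scaleAr.

Definition prod_proj_fun i (x : prodAlg) : A i := (x : prodT) i.
HB.instance Definition _ i := GRing.isLinear.Build K prodAlg (A i) *:%R
  (prod_proj_fun i) (fun _ _ _ => erefl).
Definition prod_proj i : algHom prodAlg (A i) :=
  @AlgHom K prodAlg (A i) (prod_proj_fun i) (conj erefl (fun _ _ => erefl)).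

Lemma prodP (x y : prodAlg) :
  (forall i, prod_proj i x = prod_proj i y) -> x = y.
Proof. by move=> e; apply: functional_extensionality_dep. Qed.

Section Tupling.
Variables (D : pzAlgType K) (f : forall i, algHom D (A i)).

Definition prod_tuple_fun (x : D) : prodAlg := fun i => f i x.
Fact prod_tuple_linear : linear prod_tuple_fun.
Proof. by move=> k x y; apply: prodP => i; apply: linearP. Qed.
HB.instance Definition _ := GRing.isLinear.Build K D prodAlg *:%R
  prod_tuple_fun prod_tuple_linear.
Fact prod_tuple_monoid : monoid_morphism prod_tuple_fun.
Proof.
by split=> [|x y]; apply: prodP => i; case: (alg_homM (f i)) => // _; apply.
Qed.
Definition prod_tuple : algHom D prodAlg := AlgHom prod_tuple_monoid.
End Tupling.
End ProductAlgebra.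

(** * Subalgebras cut out by a predicate *)

Section SubAlgebra.
Variables (K : pzRingType) (A : pzAlgType K) (S : {pred A}).
Hypothesis S_submod : submod_closed S.
Hypothesis S_monoid :
  1 \in S /\ (forall x y, x \in S -> y \in S -> x * y \in S).

Definition subT : Type := {x : A | x \in S}.
Definition sub_val (x : subT) : A := sval x.
HB.instance Definition _ := [isSub of subT for sub_val].
HB.instance Definition _ := [Choice of subT by <:].

Fact sub_subring_closed : subring_closed S.
Proof.
case: S_submod => S0 SP; split; [exact: S_monoid.1| |exact: S_monoid.2].
by move=> x y Sx Sy; rewrite addrC -scaleN1r; apply: SP.
Qed.
HB.instance Definition _ :=
  GRing.SubChoice_isSubPzRing.Build A S subT sub_subring_closed.

Fact sub_scale_closed (k : K) (x : A) : x \in S -> k *: x \in S.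
Proof. by case: S_submod => S0 SP Sx; rewrite -[_ *: _]addr0; apply: SP. Qed.

Definition sub_scale (k : K) (x : subT) : subT :=
  exist _ (k *: sub_val x) (sub_scale_closed k (valP x)).

Fact sub_scaleA a b x : sub_scale a (sub_scale b x) = sub_scale (a * b) x.
Proof. by apply: val_inj; apply: scalerA. Qed.
Fact sub_scale1 : left_id 1 sub_scale.
Proof. by move=> x; apply: val_inj; apply: scale1r. Qed.
Fact sub_scaleDr : right_distributive sub_scale +%R.
Proof. by move=> k x y; apply: val_inj; rewrite rmorphD; apply: scalerDr. Qed.
Fact sub_scaleDl x : {morph sub_scale^~ x : a b / a + b}.
Proof. by move=> a b; apply: val_inj; rewrite rmorphD; apply: scalerDl. Qed.
Fact sub_scaleAl k (x y : subT) : sub_scale k (x * y) = sub_scale k x * y.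
Proof. by apply: val_inj; rewrite rmorphM; apply: pz_scalerAl. Qed.
Fact sub_scaleAr k (x y : subT) : sub_scale k (x * y) = x * sub_scale k y.
Proof. by apply: val_inj; rewrite rmorphM; apply: pz_scalerAr. Qed.

Definition subAlg : pzAlgType K := @PzAlgebra K subT sub_scale
  sub_scaleA sub_scale1 sub_scaleDr sub_scaleDl sub_scaleAl sub_scaleAr.

Definition sub_incl_fun (x : subAlg) : A := sub_val x.
HB.instance Definition _ := GRing.isLinear.Build K subAlg A *:%R
  sub_incl_fun (fun _ _ _ => erefl).
Definition sub_incl : algHom subAlg A :=
  @AlgHom K subAlg A sub_incl_fun (conj erefl (fun _ _ => erefl)).

Lemma sub_incl_inj : injective sub_incl.
Proof. exact: val_inj. Qed.

Lemma sub_inclP (x : subAlg) : sub_incl x \in S.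
Proof. exact: valP. Qed.

Definition sub_lift (x : A) (Sx : x \in S) : subAlg := exist _ x Sx.
Lemma sub_liftK (x : A) (Sx : x \in S) : sub_incl (sub_lift Sx) = x.
Proof. by []. Qed.
End SubAlgebra.

(** * Algebra homomorphisms and their composites *)

Section AlgHomBasics.
Variables (K : pzRingType) (A B : pzAlgType K) (f : algHom A B).

Lemma algHom1 : f 1 = 1.
Proof. by case: (alg_homM f). Qed.

Lemma algHomM x y : f (x * y) = f x * f y.
Proof. by case: (alg_homM f) => _; apply. Qed.

Lemma algHom_prod T (s : seq T) (g : T -> A) :
  f (\prod_(a <- s) g a) = \prod_(a <- s) f (g a).
Proof. exact: (big_morph _ algHomM algHom1). Qed.
End AlgHomBasics.

Section AlgHomComp.
Variables (K : pzRingType) (A B C : pzAlgType K).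
Variables (g : algHom B C) (f : algHom A B).

Fact algHom_comp_monoid : monoid_morphism (g \o f).
Proof. by split=> [|x y] /=; rewrite ?algHom1 ?algHomM. Qed.

Definition algHom_comp : algHom A C :=
  @AlgHom K A C (g \o f : {linear A -> C}) algHom_comp_monoid.
End AlgHomComp.

(** * Degrees and monomials in a differential algebra *)

Section GradingBasics.
Variables (K : pzRingType) (B : pzAlgType K) (G : diffAlg B).

Lemma da_gr_submod n : submod_closed (da_gr G n).
Proof. by case: (da_grading G). Qed.

Lemma da_grM m n x y :
  x \in da_gr G m -> y \in da_gr G n -> x * y \in da_gr G (m + n)%N.
Proof. by case: (da_grading G) => _ [_ h] _ _; apply: h. Qed.

Lemma da_gr_in b : da_in G b \in da_gr G 0.
Proof. by apply/da_gr0; exists b. Qed.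

Lemma da_gr0_mem n : 0 \in da_gr G n.
Proof. by case: (da_gr_submod n). Qed.

Lemma da_grD n x y :
  x \in da_gr G n -> y \in da_gr G n -> x + y \in da_gr G n.
Proof. by move=> gx gy; rewrite -[x]scale1r; apply: (da_gr_submod n).2. Qed.

Lemma da_gr_sum n T (s : seq T) (p : pred T) (F : T -> G) :
  (forall t, p t -> F t \in da_gr G n) -> \sum_(t <- s | p t) F t \in da_gr G n.
Proof.
move=> h; elim/big_ind: _ => //; [exact: da_gr0_mem | exact: da_grD].
Qed.

Lemma da_leibniz0 b (x : G) :
  da_d G (da_in G b * x) = da_d G (da_in G b) * x + da_in G b * da_d G x.
Proof. by rewrite (da_leibniz _ (da_gr_in b)) expr0 scale1r. Qed.

(** Lists of any length replace the tuples of [is_calculus], so that monomials of different degrees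
    can enter one sum. *)
Definition monomial (b : B) (l : seq B) : G :=
  da_in G b * \prod_(a <- l) da_d G (da_in G a).

Lemma monomial_deg b l : monomial b l \in da_gr G (size l).
Proof.
rewrite -[size l]add0n; apply: da_grM; first exact: da_gr_in.
elim: l => [|a l IH]; first by rewrite big_nil -(algHom1 (da_in G)) da_gr_in.
by rewrite big_cons; apply: (da_grM (m := 1)) => //; apply/da_d_deg/da_gr_in.
Qed.

(** Only the coefficient is differentiated: a product of differentials is closed, by induction from
    [d 1 = 0] with the Leibniz rule and [d (d a) = 0]. *)
Lemma monomial_d b l : da_d G (monomial b l) = monomial 1 (b :: l).
Proof.
rewrite /monomial da_leibniz0 algHom1 mul1r big_cons.
suff -> : da_d G (\prod_(a <- l) da_d G (da_in G a)) = 0 by rewrite mulr0 addr0.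
elim: l {b} => [|a l IH].
  (* The Leibniz rule for [1 * 1] reads [d 1 = d 1 + d 1], whence [d 1 = 0]. *)
  have /eqP := da_leibniz0 1 1.
  by rewrite big_nil algHom1 mulr1 mulr1 mul1r -subr_eq subrr => /eqP <-.
rewrite big_cons (da_leibniz _ (da_d_deg (da_gr_in a))).
by rewrite da_dd mul0r IH mulr0 scaler0 addr0.
Qed.

(* Leibniz in the form [(da) b = d(ab) - a db]. *)
Lemma monomial_cons a b l :
  da_d G (da_in G a) * monomial b l =
    monomial 1 (a * b :: l) - monomial a (b :: l).
Proof.
rewrite /monomial algHom1 mul1r !big_cons [da_in G (a * b)]algHomM da_leibniz0.
by rewrite mulrDl !mulrA addrK.
Qed.

(** The predicate [p] restricts the number of differentials: [pred1 n] gives homogeneous sums of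
    degree [n], [predT] arbitrary ones. *)
Definition is_monomial_sum (p : pred nat) (x : G) :=
  exists2 s : seq (B * seq B),
    all (fun t => p (size t.2)) s & x = \sum_(t <- s) monomial t.1 t.2.

Hypothesis G_calculus : is_calculus G.

Lemma calculus_homogeneous n x : x \in da_gr G n -> is_monomial_sum (pred1 n) x.
Proof.
move=> /G_calculus [s ->]; exists [seq (t.1, tval t.2) | t <- s].
  by rewrite all_map; apply/allP => t _ /=; rewrite size_tuple.
by rewrite big_map.
Qed.

(** The expansions of the finitely many homogeneous components are concatenated. *)
Lemma calculus_spanned x : is_monomial_sum predT x.
Proof.
case: (da_grading G) => _ _ /(_ x) [N [c [cn ->]]] _.
elim: N => [|N [s _ e]]; first by exists [::]; rewrite ?big_ord0 ?big_nil.
have [s' _ e'] := calculus_homogeneous (cn N).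
exists (s ++ s'); first by apply/allP.
by rewrite big_ord_recr big_cat /= e e'.
Qed.
End GradingBasics.
Arguments monomial {K B} G b l.

(** Since [F] commutes with products and with [d], its restriction to degree zero determines it on
    monomials, hence on a whole calculus. *)
Lemma diffHom_monomial (K : pzRingType) (A B : pzAlgType K) (GA : diffAlg A)
    (GB : diffAlg B) (F : diffHom GA GB) (psi : A -> B) b l :
  extends F psi -> F (monomial GA b l) = monomial GB (psi b) (map psi l).
Proof.
move=> ext; rewrite /monomial algHomM algHom_prod ext big_map.
by under eq_bigr do rewrite diff_hom_d ext.
Qed.

(** * Composition of homomorphisms of differential algebras *)

Section DiffHomComp.
Variables (K : pzRingType) (A B C : pzAlgType K).
Variables (GA : diffAlg A) (GB : diffAlg B) (GC : diffAlg C).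
Variables (g : diffHom GB GC) (f : diffHom GA GB).

Fact diffHom_comp_deg n x :
  x \in da_gr GA n -> algHom_comp g f x \in da_gr GC n.
Proof. by move=> gx; do 2!apply: diff_hom_deg. Qed.

Fact diffHom_comp_d x :
  algHom_comp g f (da_d GA x) = da_d GC (algHom_comp g f x).
Proof. by rewrite /= !diff_hom_d. Qed.

Definition diffHom_comp : diffHom GA GC :=
  DiffHom diffHom_comp_deg diffHom_comp_d.
End DiffHomComp.

(** * The product of a finite family of differential algebras *)

Section ProductDiffAlg.
Variables (K : pzRingType) (I : finType) (C : I -> pzAlgType K).
Variable G : forall i, diffAlg (C i).

Let P := prodAlg G.
Local Notation pr i := (prod_proj G i).

Definition prod_gr n : {pred P} :=
  fun x => `[< forall i, pr i x \in da_gr (G i) n >].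

Lemma prod_grP n (x : P) :
  reflect (forall i, pr i x \in da_gr (G i) n) (x \in prod_gr n).
Proof. exact: asboolP. Qed.

Definition prod_in : algHom (prodAlg C) P :=
  prod_tuple (fun i => algHom_comp (da_in (G i)) (prod_proj C i)).

Definition prod_d_fun (x : P) : P := fun i => da_d (G i) (pr i x).

Lemma prod_d_linear : linear prod_d_fun.
Proof.
by move=> k x y; apply: prodP => i; exact: (linearP (da_d (G i))).
Qed.

HB.instance Definition _ :=
  GRing.isLinear.Build K P P *:%R prod_d_fun prod_d_linear.

(** Everything is componentwise except the existence of decompositions, where finiteness of [I]
    gives one bound on the degrees for all components. *)
Fact prod_grading : is_grading prod_gr.
Proof.
split.
- move=> n; split; first by apply/prod_grP => i; rewrite linear0 da_gr0_mem.
  move=> k x y /prod_grP gx /prod_grP gy; apply/prod_grP => i.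
  by rewrite linearP; case: (da_gr_submod (G i) n) => _; apply;
    [apply: gx | apply: gy].
- split; first by apply/prod_grP => i; rewrite algHom1;
    case: (da_grading (G i)) => _ [].
  move=> m n x y /prod_grP gx /prod_grP gy; apply/prod_grP => i.
  by rewrite algHomM; apply: da_grM; [apply: gx | apply: gy].
- move=> x.
  have /choice[N hN] i : exists N : nat, exists c : nat -> G i,
      (forall n, c n \in da_gr (G i) n) /\ pr i x = \sum_(n < N) c n.
    by case: (da_grading (G i)) => _ _ /(_ (pr i x)) h _.
  pose c i := sval (cid (hN i)).
  have cP i : (forall n, c i n \in da_gr (G i) n) /\
      pr i x = \sum_(n < N i) c i n by rewrite /c; case: cid.
  (* The decomposition of component [i] stops before [N i], and [c i n] may be nonzero beyond; it is
     replaced by zero there, so that the maximum serves as common bound. *)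
  exists (\max_i N i).
  exists (fun n => (fun i => if (n < N i)%N then c i n else 0) : P).
  split=> [n|].
    apply/prod_grP => i /=; rewrite /prod_proj_fun.
    by case: ifP => _; [apply: (cP i).1 | apply: da_gr0_mem].
  apply: prodP => i; rewrite (cP i).2 linear_sum /= /prod_proj_fun.
  rewrite (big_ord_widen _ (fun n => c i n) (leq_bigmax i)).
  by rewrite big_mkcond.
- move=> N c gc c0 n nN; apply: prodP => i; rewrite linear0.
  case: (da_grading (G i)) => _ _ _ /(_ N (fun n => pr i (c n))); apply => //.
    by move=> k; apply/prod_grP.
  by rewrite -linear_sum c0 linear0.
Qed.

Fact prod_in_inj : injective prod_in.
Proof.
move=> x y e; apply: prodP => i; apply: (da_in_inj (d := G i)).
exact: (congr1 (pr i) e).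
Qed.

Fact prod_gr0 x : x \in prod_gr 0 <-> exists b, x = prod_in b.
Proof.
split=> [/prod_grP gx | [b ->]]; last first.
  by apply/prod_grP => i; apply: da_gr_in.
have h i : exists b, pr i x = da_in (G i) b.
  exact: (da_gr0 (pr i x)).1 (gx i).
by exists (fun i => sval (cid (h i))); apply: prodP => i;
  apply: svalP (cid (h i)).
Qed.

Fact prod_d_deg n x : x \in prod_gr n -> prod_d_fun x \in prod_gr n.+1.
Proof. by move=> /prod_grP gx; apply/prod_grP => i; apply: da_d_deg (gx i). Qed.

Fact prod_leibniz n x y : x \in prod_gr n ->
  prod_d_fun (x * y) = prod_d_fun x * y + (-1) ^+ n *: (x * prod_d_fun y).
Proof.
by move=> /prod_grP gx; apply: prodP => i; apply: (da_leibniz _ (gx i)).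
Qed.

Fact prod_dd x : prod_d_fun (prod_d_fun x) = 0.
Proof. by apply: prodP => i; apply: (@da_dd _ _ (G i)). Qed.

(** The ambient differential algebra, over the product of the [C i]; the calculus over [B] is cut
    out of it below. *)
Definition prodDiff : diffAlg (prodAlg C) :=
  @DiffAlg K (prodAlg C) P prod_gr prod_in prod_d_fun prod_grading
    prod_in_inj prod_gr0 prod_d_deg prod_leibniz prod_dd.

Fact prod_proj_deg i n x : x \in da_gr prodDiff n -> pr i x \in da_gr (G i) n.
Proof. by move=> /prod_grP. Qed.

Definition prod_proj_diff i : diffHom prodDiff (G i) :=
  @DiffHom K (prodAlg C) (C i) prodDiff (G i) (pr i)
    (@prod_proj_deg i) (fun=> erefl).
End ProductDiffAlg.

(** * The calculus spanned by the monomials over an embedded algebra *)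

Section SubCalculus.
Variables (K : pzRingType) (B C : pzAlgType K) (P : diffAlg C).
Variable phi : algHom B C.
Hypothesis phi_inj : injective phi.

Let mono (t : B * seq B) : P := monomial P (phi t.1) (map phi t.2).

(** Plain sums already give the linear span, as scalars are absorbed into the coefficients. The
    degrees allowed are those satisfying [p]. *)
Definition dspan (p : pred nat) : {pred P} := fun x =>
  `[< exists2 s : seq (B * seq B),
       all (fun t => p (size t.2)) s & x = \sum_(t <- s) mono t >].

Lemma dspanP (p : pred nat) (x : P) :
  reflect (exists2 s : seq (B * seq B),
       all (fun t => p (size t.2)) s & x = \sum_(t <- s) mono t)
    (x \in dspan p).
Proof. exact: asboolP. Qed.

Lemma dspan_mono (p : pred nat) t : p (size t.2) -> mono t \in dspan p.
Proof. by move=> pt; apply/dspanP; exists [:: t]; rewrite ?big_seq1 //= pt. Qed.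

Lemma mono_scale k b l : k *: mono (b, l) = mono (k *: b, l).
Proof. by rewrite /mono /monomial !linearZ pz_scalerAl. Qed.

Lemma dspan_submod p : submod_closed (dspan p).
Proof.
split; first by apply/dspanP; exists [::]; rewrite ?big_nil.
move=> k x y /dspanP[s ps ->] /dspanP[s' ps' ->]; apply/dspanP.
exists ([seq (k *: t.1, t.2) | t <- s] ++ s').
  by rewrite all_cat ps' all_map /preim /= ps.
rewrite big_cat big_map scaler_sumr; congr (_ + _).
by apply: eq_bigr => -[b l] _; rewrite mono_scale.
Qed.

Lemma dspan0 p : 0 \in dspan p. Proof. by case: (dspan_submod p). Qed.

Lemma dspanD p x y : x \in dspan p -> y \in dspan p -> x + y \in dspan p.
Proof. by move=> gx gy; rewrite -[x]scale1r; apply: (dspan_submod p).2. Qed.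

Lemma dspanB p x y : x \in dspan p -> y \in dspan p -> x - y \in dspan p.
Proof. by move=> gx gy; rewrite addrC -scaleN1r; apply: (dspan_submod p).2. Qed.

(** Reduction to monomials, the common argument for the stability of the span under products and
    under [d]. *)
Lemma dspan_additive (p q : pred nat) (f : P -> P) :
  f 0 = 0 -> {morph f : x y / x + y} ->
  (forall t, p (size t.2) -> f (mono t) \in dspan q) ->
  forall x, x \in dspan p -> f x \in dspan q.
Proof.
move=> f0 fD ft x /dspanP[s ps ->].
elim: s ps => [|t s IH] /=; first by rewrite big_nil f0 dspan0.
by case/andP => pt ps; rewrite big_cons fD dspanD ?ft ?IH.
Qed.

Lemma dspan_sub (p q : pred nat) x :
  subpred p q -> x \in dspan p -> x \in dspan q.
Proof.
by move=> pq; apply: (dspan_additive (f := id)) => // t /pq; apply: dspan_mono.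
Qed.

Lemma dspan_deg n x : x \in dspan (pred1 n) -> x \in da_gr P n.
Proof.
move=> /dspanP[s /allP sn ->]; rewrite big_seq;
  apply: da_gr_sum => t /sn /eqP <-.
by rewrite -(size_map phi) monomial_deg.
Qed.

Lemma dspan_in b : da_in P (phi b) \in dspan (pred1 0%N).
Proof.
have -> : da_in P (phi b) = mono (b, [::]).
  by rewrite /mono /monomial big_nil mulr1.
exact: dspan_mono.
Qed.

Lemma dspan_inl n b x :
  x \in dspan (pred1 n) -> da_in P (phi b) * x \in dspan (pred1 n).
Proof.
apply: dspan_additive => [|y z|[a l] /= sl]; rewrite ?mulr0 ?mulrDr //.
have -> : da_in P (phi b) * mono (a, l) = mono (b * a, l).
  by rewrite /mono /monomial !algHomM mulrA.
exact: dspan_mono.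
Qed.

(** By the Leibniz rule, [da] times a monomial with coefficient [b] is a difference of two
    monomials, headed by [d(ab)] and by [a db], with one more differential each. *)
Lemma dspan_dl n a x :
  x \in dspan (pred1 n) -> da_d P (da_in P (phi a)) * x \in dspan (pred1 n.+1).
Proof.
apply: dspan_additive => [|y z|[b l] /= sl]; rewrite ?mulr0 ?mulrDr //.
rewrite /mono /= monomial_cons -!algHomM -(algHom1 phi).
apply: dspanB; first exact: (@dspan_mono _ (1, a * b :: l)).
exact: (@dspan_mono _ (a, b :: l)).
Qed.

(** With [x] reduced to a monomial, its factors act on [y] from the left one at a time: the
    differentials by [dspan_dl], then the coefficient by [dspan_inl]. *)
Lemma dspanM m n x y :
  x \in dspan (pred1 m) -> y \in dspan (pred1 n) ->
    x * y \in dspan (pred1 (m + n)%N).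
Proof.
move=> gx gy; apply: (dspan_additive (f := fun z => z * y) _ _ _ gx).
- exact: mul0r.
- by move=> z t; rewrite mulrDl.
case=> b l /= /eqP <-; rewrite /mono /monomial /= -mulrA; apply: dspan_inl.
elim: l => [|a l IH] /=; first by rewrite big_nil mul1r.
by rewrite big_cons -mulrA; apply: dspan_dl.
Qed.

Lemma dspan_d n x : x \in dspan (pred1 n) -> da_d P x \in dspan (pred1 n.+1).
Proof.
apply: dspan_additive => [|y z|[b l] /= sl]; rewrite ?linear0 ?linearD //.
by rewrite /mono /= monomial_d -(algHom1 phi);
  apply: (@dspan_mono _ (1, b :: l)).
Qed.

Lemma dspanT_monoid :
  1 \in dspan predT /\
  (forall x y, x \in dspan predT -> y \in dspan predT -> x * y \in dspan predT).
Proof.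
split.
  by rewrite -(algHom1 (da_in P)) -(algHom1 phi);
    apply: (dspan_sub _ (dspan_in 1)).
move=> x y gx gy; apply: (dspan_additive (f := fun z => z * y) _ _ _ gx).
- exact: mul0r.
- by move=> z t; rewrite mulrDl.
(* As [dspanM] concerns fixed degrees, the second factor is reduced to a monomial as well. *)
move=> t _; move: y gy; apply: dspan_additive => [|y z|u _];
  rewrite ?mulr0 ?mulrDr //.
by apply: (@dspan_sub (pred1 (size t.2 + size u.2)%N)) => //; apply: dspanM;
  apply: dspan_mono => /=.
Qed.

Let S := subAlg (dspan_submod predT) dspanT_monoid.
Let incl : algHom S P := sub_incl _ _.

Lemma incl_inj : injective incl. Proof. exact: sub_incl_inj. Qed.

Lemma dspanT n x : x \in dspan (pred1 n) -> x \in dspan predT.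
Proof. exact: dspan_sub. Qed.

Lemma dspanT_d x : x \in dspan predT -> da_d P x \in dspan predT.
Proof.
apply: dspan_additive => [|y z|t _]; rewrite ?linear0 ?linearD //.
by apply: (@dspanT (size t.2).+1); apply: dspan_d; apply: dspan_mono => /=.
Qed.

(** The degree is read off the monomials, which makes the calculus property nearly immediate;
    [dspan_deg] links it to the grading of [P]. *)
Definition sub_gr n : {pred S} := fun x => incl x \in dspan (pred1 n).

Definition sub_in_fun (b : B) : S :=
  sub_lift _ _ (dspanT (dspan_in b)).
Lemma sub_in_linear : linear sub_in_fun.
Proof.
by move=> k x y; apply: incl_inj;
  rewrite [RHS]linearP /= /sub_incl_fun /= !linearP.
Qed.
HB.instance Definition _ := GRing.isLinear.Build K B S *:%R
  sub_in_fun sub_in_linear.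
Lemma sub_in_monoid : monoid_morphism sub_in_fun.
Proof.
split=> [|x y]; apply: incl_inj; rewrite ?algHom1 ?[RHS]algHomM [LHS]sub_liftK.
  by rewrite !algHom1.
by rewrite !algHomM.
Qed.
Definition sub_in : algHom B S := AlgHom sub_in_monoid.

Definition sub_d_fun (x : S) : S := sub_lift _ _ (dspanT_d (sub_inclP x)).
Lemma sub_d_linear : linear sub_d_fun.
Proof.
by move=> k x y; apply: incl_inj; rewrite [RHS]linearP [LHS]sub_liftK !linearP.
Qed.
HB.instance Definition _ := GRing.isLinear.Build K S S *:%R
  sub_d_fun sub_d_linear.

Fact sub_grading : is_grading sub_gr.
Proof.
have sub_grE n (x : S) : (x \in sub_gr n) = (incl x \in dspan (pred1 n)) by [].
split.
- move=> n; split; first by rewrite sub_grE linear0 dspan0.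
  by move=> k x y; rewrite !sub_grE linearP; apply: (dspan_submod _).2.
- split.
    by rewrite sub_grE algHom1 -(algHom1 (da_in P)) -(algHom1 phi) dspan_in.
  by move=> m n x y; rewrite !sub_grE algHomM; apply: dspanM.
- move=> x; have /dspanP[s _ e] := sub_inclP x.
  (* The homogeneous components are obtained by sorting the monomials by their number of
     differentials. *)
  have gc n : \sum_(t <- s | size t.2 == n) mono t \in dspan (pred1 n).
    apply/dspanP; exists [seq t <- s | size t.2 == n]; first exact: filter_all.
    by rewrite big_filter.
  (* The successor is required because the decomposition runs over indices strictly below the
     bound. *)
  exists (\max_(t <- s) size t.2).+1, (fun n => sub_lift _ _ (dspanT (gc n))).
  split=> [n|]; first by rewrite sub_grE sub_liftK.
  apply: incl_inj; rewrite linear_sum [LHS]e.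
  under [RHS]eq_bigr do rewrite [incl _]sub_liftK big_mkcond.
  (* After the exchange of sums, each monomial contributes at exactly one index, its own degree. *)
  rewrite exchange_big /= [LHS]big_seq [RHS]big_seq; apply: eq_bigr => t ts.
  have ht : (size t.2 < (\max_(t <- s) size t.2).+1)%N.
    by rewrite ltnS; apply: (leq_bigmax_seq (F := fun t => size t.2)) ts _.
  rewrite (bigD1 (Ordinal ht)) //= eqxx big1 ?addr0 // => n ne.
  by case: eqP => // en; move: ne; rewrite -val_eqE /= en eqxx.
- move=> N c gc c0 n nN; apply: incl_inj; rewrite linear0.
  (* Independence of the components is inherited from the grading of [P]. *)
  case: (da_grading P) => _ _ _ /(_ N (fun n => incl (c n))); apply => //.
    by move=> k; apply/dspan_deg/gc.
  by rewrite -linear_sum c0 linear0.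
Qed.

Fact sub_in_inj : injective sub_in.
Proof. by move=> x y /(congr1 incl) /da_in_inj /phi_inj. Qed.

(** A monomial without differentials is just its coefficient, so degree zero shrinks to the image of
    [B], even where degree zero of [P] is larger. *)
Fact sub_gr0 x : x \in sub_gr 0 <-> exists b, x = sub_in b.
Proof.
split=> [/dspanP[s s0 e] | [b ->]]; last exact: dspan_in.
exists (\sum_(t <- s) t.1); apply: incl_inj;
  rewrite e [RHS]sub_liftK !linear_sum /=.
rewrite !big_seq; apply: eq_bigr => t /(allP s0).
by rewrite /mono /monomial => /eqP /size0nil ->; rewrite big_nil mulr1.
Qed.

Fact sub_d_deg n x : x \in sub_gr n -> sub_d_fun x \in sub_gr n.+1.
Proof. exact: dspan_d. Qed.

Fact sub_leibniz n x y : x \in sub_gr n ->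
  sub_d_fun (x * y) = sub_d_fun x * y + (-1) ^+ n *: (x * sub_d_fun y).
Proof.
move=> gx; apply: incl_inj; rewrite [LHS]sub_liftK algHomM.
rewrite (da_leibniz _ (dspan_deg gx)).
by rewrite linearD linearZ !algHomM.
Qed.

Fact sub_dd x : sub_d_fun (sub_d_fun x) = 0.
Proof. by apply: incl_inj; rewrite [LHS]sub_liftK linear0 da_dd. Qed.

Definition subDiff : diffAlg B :=
  @DiffAlg K B S sub_gr sub_in sub_d_fun sub_grading
    sub_in_inj sub_gr0 sub_d_deg sub_leibniz sub_dd.

Definition sub_diffHom : diffHom subDiff P :=
  @DiffHom K B C subDiff P incl (fun n x gx => dspan_deg gx) (fun=> erefl).

Lemma sub_diffHom_inj : injective sub_diffHom.
Proof. exact: incl_inj. Qed.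

Lemma sub_diffHom_ext : extends sub_diffHom phi.
Proof. by []. Qed.

Lemma sub_calculus : is_calculus subDiff.
Proof.
move=> n x /dspanP[s /allP sn e].
(* All the lists have length [n], so they can be repackaged as tuples. *)
have [s' e'] : exists s' : seq (B * n.-tuple B),
    \sum_(t <- s) mono t = \sum_(t <- s') mono (t.1, tval t.2).
  elim: s sn {e} => [|[b l] s IH] sn; first by exists [::]; rewrite !big_nil.
  have sl : size l == n by apply: (sn (b, l)); rewrite inE eqxx.
  have [|s' e] := IH; first by move=> t ts; apply: sn; rewrite inE ts orbT.
  by exists ((b, Tuple sl) :: s'); rewrite !big_cons e.
exists s'; apply: incl_inj; rewrite e e' linear_sum /=; apply: eq_bigr => t _.
(* The inclusion carries monomials formed in the span to those formed in [P]. *)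
exact/esym/(diffHom_monomial _ _ sub_diffHom_ext).
Qed.
End SubCalculus.

(** * Comparison of calculi through jointly injective families *)

Section Comparison.
Variables (K : pzRingType) (B : pzAlgType K) (I : Type).
Variables (C : I -> pzAlgType K) (Gq : forall i, diffAlg (C i)).
Variables (pi : forall i, B -> C i) (G G' : diffAlg B).
Hypothesis G_calculus : is_calculus G.
Variables (F : forall i, diffHom G (Gq i)) (F' : forall i, diffHom G' (Gq i)).
Hypotheses (F_ext : forall i, extends (F i) (pi i)).
Hypotheses (F'_ext : forall i, extends (F' i) (pi i)).
Hypothesis F'_inj : forall x y, (forall i, F' i x = F' i y) -> x = y.

(** A sum of monomials in [G] is sent to the same sum in [G']. All identities required of this map
    are checked after applying the [F' i], which are jointly injective. *)
Lemma comparison_diffHom :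
  exists2 f : diffHom G G', (forall i x, F' i (f x) = F i x) & extends f id.
Proof.
have FF' i s : F' i (\sum_(t <- s) monomial G' t.1 t.2) =
    F i (\sum_(t <- s) monomial G t.1 t.2).
  rewrite !linear_sum; apply: eq_bigr => t _.
  rewrite (diffHom_monomial _ _ (@F_ext i)).
  by rewrite (diffHom_monomial _ _ (@F'_ext i)).
(* The value is characterised by its images under the [F' i], so independence of the chosen
   expansion is automatic. *)
have /choice[f fP] x : exists y, forall i, F' i y = F i x.
  have [s _ ->] := calculus_spanned G_calculus x.
  by exists (\sum_(t <- s) monomial G' t.1 t.2).
have f_lin : linear f.
  by move=> k x y; apply: F'_inj => i; rewrite linearP !fP linearP.
have f_mon : monoid_morphism f.
  by split=> [|x y]; apply: F'_inj => i; rewrite ?algHomM ?fP ?algHom1 ?algHomM.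
pose f' : {linear G -> G'} :=
  HB.pack (f : G -> G') (GRing.isLinear.Build K G G' *:%R f f_lin).
have f_deg n x : x \in da_gr G n -> f x \in da_gr G' n.
  move=> /(calculus_homogeneous G_calculus)[s /allP sn e].
  (* Any expansion of [x] computes [f x], in particular one into monomials of degree [n]. *)
  have -> : f x = \sum_(t <- s) monomial G' t.1 t.2.
    by apply: F'_inj => i; rewrite fP FF' e.
  by rewrite big_seq; apply: da_gr_sum => t /sn /eqP <-; apply: monomial_deg.
have f_d x : f (da_d G x) = da_d G' (f x).
  by apply: F'_inj => i; rewrite fP !diff_hom_d fP.
exists (@DiffHom K B B G G' (@AlgHom K G G' f' f_mon) f_deg f_d) => [i x|b].
  exact: fP.
by apply: F'_inj => i; rewrite [F' i _]fP F_ext F'_ext.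
Qed.
End Comparison.

(** * Coverings as joint injectivity, and the final construction *)

Lemma covering_inj (K : pzRingType) (A : pzAlgType K) (I : finType)
    (B : I -> pzAlgType K) (f : forall i, algHom A (B i)) :
  covering (fun i => kerI (f i)) ->
  forall x y, (forall i, f i x = f i y) -> x = y.
Proof.
move=> cov x y e; apply/eqP; rewrite -subr_eq0; apply/eqP/cov => i.
by rewrite unfold_in /= linearB e subrr.
Qed.

Lemma inj_covering (K : pzRingType) (A : pzAlgType K) (I : finType)
    (B : I -> pzAlgType K) (f : forall i, algHom A (B i)) :
  (forall x y, (forall i, f i x = f i y) -> x = y) ->
  covering (fun i => kerI (f i)).
Proof.
move=> inj x; split=> [x0 | -> i]; last by rewrite unfold_in /= linear0.
by apply: inj => i; rewrite linear0; apply/eqP/x0.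
Qed.

(** The covering property of the [J i] embeds [B] into the product of its quotients, as the
    construction of the span demands. *)
Lemma quot_tuple_inj (K : pzRingType) (B : pzAlgType K) (I : finType)
    (J : I -> twoSidedIdeal B) :
  covering J -> injective (prod_tuple (fun i => quot_pi (J i))).
Proof.
move=> cov x y e; apply/eqP; rewrite -subr_eq0; apply/eqP/cov => i.
by apply/quot_projP; apply: (congr1 (prod_proj _ i) e).
Qed.

Theorem proposition11 (R : realType) (B : pzAlgType R[i]%C) (I : finType)
    (J : I -> twoSidedIdeal B) (hJ : covering J)
    (Gq : forall i : I, diffAlg (quotAlg (J i)))
    (hGq : forall i : I, is_calculus (Gq i)) :
  exists G : diffAlg B,
    [/\ is_calculus G, adapted G Gq &
        forall G' : diffAlg B,
          is_calculus G' -> adapted G' Gq -> calculus_iso G G'].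
Proof.
pose G := subDiff (prodDiff Gq) (quot_tuple_inj hJ).
(* The extensions of the quotient maps are the coordinate projections restricted to the span; they
   are jointly injective because elements of a product are determined by their components. *)
pose F i : diffHom G (Gq i) :=
  diffHom_comp (prod_proj_diff Gq i) (sub_diffHom _ (quot_tuple_inj hJ)).
have F_ext i : extends (F i) (quot_pi (J i)) by [].
have F_inj x y : (forall i, F i x = F i y) -> x = y.
  by move=> e; apply: sub_diffHom_inj; apply: prodP.
have G_calc : is_calculus G by apply: sub_calculus.
exists G; split=> //; first by exists F; split=> //; apply: inj_covering.
move=> G' G'_calc [F' [F'_ext /covering_inj F'_inj]].
have [f fP f_ext] := comparison_diffHom G_calc F_ext F'_ext F'_inj.
have [g gP _] := comparison_diffHom G'_calc F'_ext F_ext F_inj.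
(* Both composites preserve the images under a jointly injective family, hence are identities. *)
exists f, g; split=> // x.
  by apply: F_inj => i; rewrite gP fP.
by apply: F'_inj => i; rewrite fP gP.
Qed.
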